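(* Let $A\in\mathbb{Z}^{m\times n}$ be non-degenerate with $\operatorname{rank}(A)=n$ and set $\Delta:=\Delta(A)$, where $\Delta\ge 2$. Then $$i(A,b)\le\big[4\Delta^{1/2}+\log_2(\Delta)\big]\cdot\big[\Delta^{6+\log_2\log_2(\Delta)}+1\big]\qquad\text{for all } b\in\mathbb{Z}^m.$$
   Context: A matrix $A\in\mathbb{Z}^{m\times n}$ is non-degenerate if $\det(B)\neq0$ for every $n\times n$ submatrix $B$ of $A$. $\Delta(A):=\max\{|\det(B)| : B \text{ is a } \operatorname{rank}(A)\times\operatorname{rank}(A)\text{ submatrix of } A\}$, so here it is the largest absolute value of an $n\times n$ subdeterminant of $A$. Let $P(A,b):=\{x\in\mathbb{R}^n : Ax\le b\}$ and $\mathrm{IP}(A,b):=\operatorname{conv}\{x\in P(A,b): x\in\mathbb{Z}^n\}$. For $W\in\mathbb{Z}^{k\times n}$ let $W\text{-}\mathrm{MIP}(A,b):=\operatorname{conv}\{x\in P(A,b): Wx\in\mathbb{Z}^k\}$ (for $k=0$ this equals $P(A,b)$). The integrality number is $$i(A,b):=\min\{k\in\mathbb{Z}_{\ge 0}: \exists\, W\in\mathbb{Z}^{k\times n}\text{ with } W\text{-}\mathrm{MIP}(A,b)=\mathrm{IP}(A,b)\}.$$ *)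

(* Defs.v *)
From mathcomp Require Import all_boot all_order all_algebra.
From mathcomp Require Import all_classical all_reals all_analysis.

Set Implicit Arguments.
Unset Strict Implicit.
Unset Printing Implicit Defensive.

Import Order.TTheory GRing.Theory Num.Theory.
Local Open Scope classical_set_scope.
Local Open Scope ring_scope.

Definition increasing (k p : nat) (f : 'I_k -> 'I_p) : bool :=
  [forall i : 'I_k, forall j : 'I_k, (i < j)%N ==> (f i < f j)%N].

(* A k x k submatrix of A is mxsub f g A for increasing selections f of the
   rows and g of the columns. *)
Definition non_degenerate (m n : nat) (A : 'M[int]_(m, n)) : Prop :=
  forall (f : 'I_n -> 'I_m) (g : 'I_n -> 'I_n),
    increasing f -> increasing g -> \det (mxsub f g A) != 0.

Definition int_rank (m n : nat) (A : 'M[int]_(m, n)) : nat :=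
  \rank (map_mx intr A : 'M[rat]_(m, n)).

Definition Delta (m n : nat) (A : 'M[int]_(m, n)) : nat :=
  let r := int_rank A in
  \max_(f : {ffun 'I_r -> 'I_m} | increasing f)
    \max_(g : {ffun 'I_r -> 'I_n} | increasing g)
      `|\det (mxsub f g A)|%N.

Section Polyhedra.
Context (R : realType).

Definition convex_hull (n : nat) (S : set 'cV[R]_n) : set 'cV[R]_n :=
  smallest (fun C : set 'cV[R]_n =>
              convex_set (C : set (convex_lmodType 'cV[R]_n))) S.

Definition polyhedron (m n : nat) (A : 'M[int]_(m, n)) (b : 'cV[int]_m) :
    set 'cV[R]_n :=
  [set x | forall i, (map_mx intr A *m x) i 0 <= (b i 0)%:~R].

Definition integer_hull (m n : nat) (A : 'M[int]_(m, n)) (b : 'cV[int]_m) :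
    set 'cV[R]_n :=
  convex_hull [set x | polyhedron A b x /\ x \is a mxOver Num.int].

Definition mixed_integer_hull (k m n : nat) (W : 'M[int]_(k, n))
    (A : 'M[int]_(m, n)) (b : 'cV[int]_m) : set 'cV[R]_n :=
  convex_hull [set x | polyhedron A b x /\ map_mx intr W *m x \is a mxOver Num.int].

Lemma ex_integrality (m n : nat) (A : 'M[int]_(m, n)) (b : 'cV[int]_m) :
  exists k, `[< exists W : 'M[int]_(k, n),
                  mixed_integer_hull W A b = integer_hull A b >].
Proof.
exists n; apply/asboolP; exists 1%:M.
rewrite /mixed_integer_hull /integer_hull.
by congr convex_hull; apply/seteqP; split=> x /=; rewrite map_mx1 mul1mx.
Qed.

(* The minimum exists since W = 1%:M is always admissible. *)
Definition integrality_number (m n : nat) (A : 'M[int]_(m, n))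
    (b : 'cV[int]_m) : nat :=
  ex_minn (ex_integrality A b).

Definition log2 (x : R) : R := ln x / ln 2.

End Polyhedra.

Arguments polyhedron R {m n} A b _.
Arguments integer_hull R {m n} A b _.
Arguments mixed_integer_hull R {k m n} W A b _.
Arguments integrality_number R {m n} A b.

(* Main.v *)
Require Import Defs.
From mathcomp Require Import all_boot all_order all_fingroup all_algebra.
From mathcomp Require Import all_classical all_reals all_analysis.
From mathcomp Require Import zify ring lra.

(** The proof establishes the stronger bound [i(A,b) <= (2 Delta + 1)^2], which
    does not depend on [n]; already [4 Delta^6] exceeds it when [Delta >= 2].

    If [n <= (2 Delta + 1)^2], imposing integrality on every variable is cheap
    enough. Otherwise let [B] consist of the first [n] rows of [A]. By Cramer's
    rule the entries of [A * adj B] on a row outside [B] are, up to sign,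
    [n x n] minors of [A], hence of absolute value at most [Delta].
    If two columns of [A * adj B] agreed on two rows outside [B], exchanging
    these two rows into [B] would produce a vanishing minor
    ([double_exchange_det_eq0]), against non-degeneracy. By pigeonhole on the
    columns, at most one row of [A] lies outside [B] when [n] is this large.

    Now describe a point [x] by its slack [y = b_B - B x >= 0]. Call two
    indices equivalent when their unit vectors agree modulo the lattice
    [B Z^n] and when the extra row of [A * adj B] takes the same value at
    them. There are at most [|det B| (2 Delta + 1)] classes. Mass can be moved
    between the coordinates of [y] inside a class without leaving the
    polyhedron, for the extra constraint depends only on the class sums of
    [y]; and for integral [y] the integrality of [x] depends only on the class
    sums too. So let [W] impose that the class sums are integral and that [y]
    satisfies the congruences that make [x] integral, which by the Smith
    normal form of [B] are at most [log2 |det B|] in number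
    ([quotient_characters]). A slack with integral class sums is a convex
    combination of integral slacks with the same class sums
    ([class_sum_rounding]), and each of these belongs to an integral point of
    the polyhedron. Hence [i(A,b) <= |det B| (2 Delta + 1) + |det B|]
    ([integrality_number_classes]), and this is at most [(2 Delta + 1)^2]. *)

Set Implicit Arguments.
Unset Strict Implicit.
Unset Printing Implicit Defensive.

Import Order.TTheory GRing.Theory Num.Theory.
Local Open Scope ring_scope.

(** * Rounding with prescribed class sums *)

Section ClassSums.
Variables (R : realType) (n : nat) (T : finType) (c : 'I_n -> T).
Implicit Types y z : 'cV[R]_n.

Definition class_sum y t : R := \sum_(i | c i == t) y i 0.

Definition fractional y : {set 'I_n} := [set i | y i 0 \isn't a Num.int].

Lemma class_sum_shift y i j (a : R) t : c i = c j ->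
  class_sum (y + a *: (delta_mx i 0 - delta_mx j 0)) t = class_sum y t.
Proof.
have sumd k : \sum_(l | c l == t) (delta_mx k 0 : 'cV[R]_n) l 0 = (c k == t)%:R.
  have [ckt|ckt] := boolP (c k == t).
    rewrite (bigD1 k) //= mxE !eqxx big1 ?addr0 // => l /andP[_ lk].
    by rewrite mxE (negPf lk).
  rewrite big1 // => l /eqP clt; rewrite mxE.
  by case: eqP => // lk; rewrite -lk clt eqxx in ckt.
move=> cij; rewrite /class_sum.
pose e k : 'cV[R]_n := delta_mx k 0.
rewrite (eq_bigr (fun l => y l 0 + a * (e i l 0 - e j l 0))) => [|l _].
  by rewrite big_split -mulr_sumr sumrB /= !sumd cij subrr mulr0 addr0.
by rewrite !mxE.
Qed.

(** An integral sum cannot have exactly one fractional term. *)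
Lemma fractional_partner y i : i \in fractional y ->
    class_sum y (c i) \is a Num.int ->
  exists j, [/\ j != i, c j = c i & j \in fractional y].
Proof.
rewrite inE => yi yint; apply: contrapT => noj.
move/negP: yi; apply; move: yint.
rewrite /class_sum (bigD1 i) //= rpredDr //.
apply: rpred_sum => j /andP[/eqP cji ji].
apply: contrapT => /negP yj; apply: noj; exists j; split => //.
by rewrite inE.
Qed.

(** The shift stops as soon as coordinate [i] reaches the next integer above or
    coordinate [j] the next integer below. *)
Lemma shift_to_integer y i j : i != j -> (forall k, 0 <= y k 0) ->
    i \in fractional y -> j \in fractional y ->
  exists2 a : R, 0 < a &
    let z := y + a *: (delta_mx i 0 - delta_mx j 0) in
    (forall k, 0 <= z k 0) /\ (#|fractional z| < #|fractional y|)%N.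
Proof.
move=> ij y0; rewrite !inE => fi fj.
pose p := (Num.floor (y i 0) + 1)%:~R - y i 0.
pose q := y j 0 - (Num.floor (y j 0))%:~R.
have p0 : 0 < p by rewrite subr_gt0 floorD1_gt.
have q0 : 0 < q.
  by rewrite subr_gt0 lt_neqAle floor_le_tmp andbT -intrEfloor.
have jq : Num.min p q <= y j 0.
  rewrite ge_min /q; apply/orP; right.
  by rewrite gerBl ler0z floor_ge0.
have a0 : 0 < Num.min p q by rewrite lt_min p0.
exists (Num.min p q) => //=.
set z := y + _.
have zE k : z k 0 = y k 0 + Num.min p q * ((k == i)%:R - (k == j)%:R).
  by rewrite !mxE !eqxx !andbT.
have zi : z i 0 = y i 0 + Num.min p q.
  by rewrite zE eqxx (negPf ij) subr0 mulr1.
have zj : z j 0 = y j 0 - Num.min p q.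
  by rewrite zE eqxx eq_sym (negPf ij) sub0r mulrN1.
have zk k : k != i -> k != j -> z k 0 = y k 0.
  by move=> ki kj; rewrite zE (negPf ki) (negPf kj) subrr mulr0 addr0.
split=> [k|].
  have [->|ki] := eqVneq k i; first by rewrite zi addr_ge0 // ltW.
  have [->|kj] := eqVneq k j; first by rewrite zj subr_ge0.
  by rewrite zk.
apply: proper_card; apply/properP; split.
  apply/fintype.subsetP => k; rewrite !inE; apply: contraNN => yk.
  have ki : k != i by apply: contraNneq fi => <-.
  have kj : k != j by apply: contraNneq fj => <-.
  by rewrite zk.
have [pq|qp] := leP p q.
  exists i; rewrite !inE // zi negbK (min_idPl pq) /p addrC subrK.
  exact: intr_int.
exists j; rewrite !inE // zj negbK (min_idPr (ltW qp)) /q opprB addrC subrK.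
exact: intr_int.
Qed.

(** A fractional coordinate shares its class with another one. Shifting mass
    between the two, in either direction, until one of them becomes integral
    keeps the class sums, and [y] lies on the segment between the two results;
    iterate on the number of fractional coordinates. *)
Lemma class_sum_rounding (Q : 'cV[R]_n -> Prop) y :
    (forall u v (t : R), 0 <= t <= 1 -> Q u -> Q v ->
       Q (t *: u + (1 - t) *: v)) ->
    (forall i, 0 <= y i 0) -> (forall t, class_sum y t \is a Num.int) ->
    (forall z, (forall i, 0 <= z i 0) -> z \is a mxOver Num.int ->
       class_sum z =1 class_sum y -> Q z) ->
  Q y.
Proof.
move=> Qconv; move N : #|fractional y| => k.
elim/ltn_ind: k y N => k IH y yk y0 yint Qint.
have [f0|[i fi]] := set_0Vmem (fractional y).
  apply: Qint => //; apply/mxOverP => i j; rewrite (ord1 j).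
  by have := finset.in_set0 i; rewrite -f0 inE => /negbFE.
have [j [ji cji fj]] := fractional_partner fi (yint _).
have ij : i != j by rewrite eq_sym.
have [a a0 [u0 ult]] := shift_to_integer ij y0 fi fj.
have [b b0 [v0 vlt]] := shift_to_integer ji y0 fj fi.
set u := y + _ in u0 ult; set v := y + _ in v0 vlt.
have su : class_sum u =1 class_sum y by move=> t; apply: class_sum_shift.
have sv : class_sum v =1 class_sum y by move=> t; apply: class_sum_shift.
have QP w : class_sum w =1 class_sum y -> (forall k, 0 <= w k 0) ->
    (#|fractional w| < #|fractional y|)%N -> Q w.
  move=> sw w0; rewrite yk => wk; apply: (IH _ wk w) => // [t|z z0 zint sz].
    by rewrite sw.
  by apply: Qint => // t; rewrite sz sw.
have -> : y = (b / (a + b)) *: u + (1 - b / (a + b)) *: v.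
  apply/matrixP => l l'; rewrite !mxE; field.
  by rewrite gt_eqF // addr_gt0.
apply: Qconv; try by apply: QP.
by rewrite ler_pdivrMr ?addr_gt0 // mul1r lerDr divr_ge0 ?ltW ?addr_gt0.
Qed.

(** A linear form with equal coefficients on each class factors through the
    class sums. *)
Lemma class_constant_sum_eq0 (g : 'I_n -> R) (d : 'cV[R]_n) :
    (forall i j, c i = c j -> g i = g j) -> (forall t, class_sum d t = 0) ->
  \sum_i g i * d i 0 = 0.
Proof.
move=> gc d0; rewrite (partition_big c xpredT) //=.
apply: big1 => t _.
have [/existsP[i0 /eqP ci0]|/existsPn no] := boolP [exists i, c i == t].
  rewrite (eq_bigr (fun i => g i0 * d i 0)) => [|i /eqP ci].
    by rewrite -mulr_sumr -/(class_sum d t) d0 mulr0.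
  by congr (_ * _); apply: gc; rewrite ci0.
by rewrite big_pred0 // => i; exact: negbTE (no i).
Qed.

End ClassSums.

(** * Convexity of the integer hull and bounds on the integrality number *)

Lemma convex_set_convex_hull (R : realType) n (S : set 'cV[R]_n) :
  convex_set (convex_hull S : set (convex_lmodType 'cV[R]_n)).
Proof.
move=> u v t; rewrite !inE => hu hv C [Cconv subC].
have := Cconv u v t; rewrite !inE; apply; [exact: hu | exact: hv].
Qed.

Section IntegerHull.
Variables (R : realType) (m n : nat) (A : 'M[int]_(m, n)) (b : 'cV[int]_m).

Lemma integer_hull_conv (u v : 'cV[R]_n) (t : R) : 0 <= t <= 1 ->
  integer_hull R A b u -> integer_hull R A b v ->
  integer_hull R A b (t *: u + (1 - t) *: v).
Proof.
move=> /andP[t0 t1] hu hv.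
have := @convex_set_convex_hull R n _ u v (Itv01 t0 t1) (mem_set hu) (mem_set hv).
by rewrite inE.
Qed.

Lemma integrality_number_min k (W : 'M[int]_(k, n)) :
  mixed_integer_hull R W A b = integer_hull R A b ->
  (integrality_number R A b <= k)%N.
Proof.
move=> WA; rewrite /integrality_number; case: ex_minnP => l _; apply.
by apply/asboolP; exists W.
Qed.

Lemma integrality_number_le_dim : (integrality_number R A b <= n)%N.
Proof.
apply: (@integrality_number_min _ 1%:M).
rewrite /mixed_integer_hull /integer_hull; congr convex_hull.
by apply/seteqP; split=> x /=; rewrite map_mx1 mul1mx.
Qed.

(** Only one inclusion between the hulls needs an argument, and the integer hull
    being convex it is enough to treat the points of the relaxation. Indexing
    the rows of [W] by an arbitrary finite type avoids numbering them. *)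
Lemma integrality_number_le_card (I : finType) (w : I -> 'rV[int]_n) :
    (forall x : 'cV[R]_n, polyhedron R A b x ->
      (forall i, (map_mx intr (w i) *m x) 0 0 \is a Num.int) ->
      integer_hull R A b x) ->
  (integrality_number R A b <= #|I|)%N.
Proof.
move=> hw; pose W := \matrix_(k < #|I|) w (enum_val k).
apply: (@integrality_number_min _ W); apply/seteqP; split.
  apply: smallest_sub => [|x [/= Px /mxOverP Wx]].
    exact: convex_set_convex_hull.
  apply: hw => // i; have := Wx (enum_rank i) 0.
  rewrite !mxE; congr (_ \is a _); apply: eq_bigr => j _.
  by rewrite !mxE enum_rankK.
apply: sub_smallest2r => [|x [Px xint]]; first 
  exact: convex_set_convex_hull.
split=> //; apply: mxOverM => //; apply/mxOverP => i j.
by rewrite mxE; apply: intr_int.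
Qed.

End IntegerHull.
(** * Characters of the quotient of Z^n by a full rank lattice *)

Lemma absz_det_unitmx n (U : 'M[int]_n) : U \in unitmx -> `|\det U|%N = 1%N.
Proof. by rewrite unitmxE => /orP[] /eqP ->. Qed.

Lemma absz_prod (I : finType) (d : I -> int) :
  `|(\prod_i d i)%R|%N = (\prod_i `|d i|)%N.
Proof. exact: (big_morph absz abszM). Qed.

(** [Z^n / B Z^n] has order [|det B|], [c i] is the class of the [i]-th unit
    vector, and row [k] of [V * B^-1] is a character of this group, lifted to
    rational numbers that depend only on the class. For an integral slack [y],
    the point [B^-1 (b - y)] is integral as soon as [V] maps it to an integral
    vector, by unimodularity of [V + Q B]. With the Smith form [B = L D U], the
    row of [L^-1] that belongs to the invariant factor [e k] is divided by
    [e k]: remainders define the classes and [V], quotients define [Q].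
    Invariant factors that are units give trivial characters; each other one
    is at least 2 in absolute value, whence the bound on the nonzero rows. *)
Lemma quotient_characters n (B : 'M[int]_n) : \det B != 0 ->
  exists (T : finType) (c : 'I_n -> T) (V Q : 'M[int]_n),
  [/\ V + Q *m B \in unitmx,
      forall k i j, c i = c j -> (V *m \adj B) k i = (V *m \adj B) k j,
      #|T| = `|\det B|%N & (2 ^ #|[pred k | row k V != 0%R]| <= `|\det B|)%N].
Proof.
move=> B0.
have [L Lu [U Uu [d _ BE]]] := int_Smith_normal_form B.
pose e (k : 'I_n) : int := d`_k.
have SE : \matrix_(i, j) (d`_i *+ (i == j :> nat)) = diag_mx (\row_k e k).
  by apply/matrixP => i j; rewrite !mxE.
have detE : `|\det B|%N = (\prod_k `|e k|)%N.
  rewrite BE SE !det_mulmx !abszM (absz_det_unitmx Lu) (absz_det_unitmx Uu).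
  rewrite mul1n muln1 det_diag.
  by rewrite absz_prod; apply: eq_bigr => k _; rewrite mxE.
have e0 k : e k != 0.
  have: (0 < `|\det B|)%N by rewrite absz_gt0.
  by rewrite detE => /gt0_prodn/(_ k isT); rewrite absz_gt0.
pose D : 'M[int]_n := diag_mx (\row_k e k); pose F := invmx L.
pose Q : 'M[int]_n := \matrix_(k, i) (F k i %/ e k)%Z.
pose r : 'M[int]_n := \matrix_(k, i) (F k i %% e k)%Z.
pose V := U - Q *m B.
have FE : F = D *m Q + r.
  apply/matrixP => k i; rewrite mxE mul_diag_mx !mxE.
  by rewrite mulrC -divz_eq.
have VE : D *m V = r *m B.
  have DU : D *m U = F *m B by rewrite BE SE -!mulmxA mulKmx.
  by rewrite mulmxBr DU FE mulmxDl mulmxA addrC addKr.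
have VadjE k i : e k * (V *m \adj B) k i = r k i * \det B.
  have : (D *m (V *m \adj B)) k i = (\det B *: r) k i.
    by rewrite mulmxA VE -mulmxA mul_mx_adj mul_mx_scalar.
  by rewrite mul_diag_mx !mxE => ->; rewrite mulrC.
have rlt k i : (`|r k i| < `|e k|)%N.
  by rewrite mxE -ltz_nat gez0_abs ?modz_ge0 // ltz_mod.
pose c i : fprod (fun k : 'I_n => 'I_(`|e k|)) := [fprod k => Ordinal (rlt k i)].
exists (fprod (fun k : 'I_n => 'I_(`|e k|)) : finType), c, V, Q; split.
- by rewrite /V subrK.
- move=> k i j cij; apply: (mulfI (e0 k)); rewrite !VadjE; congr (_ * _).
  have := congr1 (fun f : fprod _ => val (f k)) cij.
  rewrite !fprodE /= !mxE => rij.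
  by rewrite -[LHS]gez0_abs ?modz_ge0 // rij gez0_abs ?modz_ge0.
- by rewrite card_fprod detE; apply: eq_bigr => k _; rewrite card_ord.
rewrite detE (bigID (fun k => row k V != 0)) /=.
rewrite -[X in (X <= _)%N]muln1 leq_mul //.
  rewrite -prod_nat_const; apply: leq_prod => k; apply: contraNT.
  rewrite -leqNgt leq_eqVlt ltnS leqn0 absz_eq0 (negPf (e0 k)) orbF => ek1.
  apply/eqP/rowP => j; rewrite [LHS]mxE [RHS]mxE.
  apply: (mulfI (e0 k)); rewrite mulr0.
  transitivity ((D *m V) k j); first by rewrite mul_diag_mx !mxE.
  rewrite VE [LHS]mxE big1 // => i _.
  move: (rlt k i); rewrite (eqP ek1) ltnS leqn0 absz_eq0 => /eqP ->.
  by rewrite mul0r.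
by rewrite prodn_gt0 // => k; rewrite absz_gt0.
Qed.

(** * Relaxations that see only class sums of the slack *)

(** The value of [w * v] is [(w * B^-1) * (B * v)], a combination of the class
    sums of [B * v]; multiplying by [det B] makes the coefficients integral. *)
Lemma class_constant_row_eq0 (R : realType) n (T : finType) (c : 'I_n -> T)
    (B : 'M[int]_n) (w : 'rV[int]_n) (v : 'cV[R]_n) :
    \det B != 0 ->
    (forall i j, c i = c j -> (w *m \adj B) 0 i = (w *m \adj B) 0 j) ->
    (forall t, class_sum c (map_mx intr B *m v) t = 0) ->
  map_mx intr w *m v = 0.
Proof.
move=> B0 wc v0.
have dw : (\det B)%:~R *: (map_mx intr w *m v)
        = map_mx intr (w *m \adj B) *m (map_mx intr B *m v).
  rewrite mulmxA -map_mxM -mulmxA mul_adj_mx map_mxM map_scalar_mx.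
  by rewrite -mulmxA mul_scalar_mx scalemxAr.
apply/colP => i; rewrite (ord1 i) [RHS]mxE.
have /eqP := congr1 (fun M : 'cV[R]_1 => M 0 0) dw.
rewrite [X in X == _]mxE [X in _ == X]mxE.
under eq_bigr do rewrite [map_mx _ _ _ _]mxE.
pose g j : R := ((w *m \adj B) 0 j)%:~R.
rewrite (class_constant_sum_eq0 (c := c) (g := g)) //.
  by rewrite mulf_eq0 intr_eq0 (negPf B0) => /eqP.
by move=> j j' cjj'; rewrite /g (wc _ _ cjj').
Qed.

Lemma mulmx_int_row (R : realType) k n (W : 'M[int]_(k, n)) (x : 'cV[R]_n) i :
  (map_mx intr (row i W) *m x) 0 0 = (map_mx intr W *m x) i 0.
Proof. by rewrite map_row -row_mul mxE. Qed.

Lemma mxOver_int_map (R : realType) k n (W : 'M[int]_(k, n)) :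
  map_mx intr W \is a mxOver (Num.int : qualifier _ R).
Proof. by apply/mxOverP => i j; rewrite mxE; apply: intr_int. Qed.

(** The classes are those of the lattice [B Z^n], refined by [c]. The first
    refinement preserves integrality when mass moves inside a class of the
    slack, the second preserves the inequalities outside [B]. *)
Lemma integrality_number_classes (R : realType) m n (A : 'M[int]_(m, n))
    (b : 'cV[int]_m) (f : 'I_n -> 'I_m) (T : finType) (c : 'I_n -> T) :
  let B := rowsub f A in
    \det B != 0 ->
    (forall i, i \notin codom f -> forall j j', c j = c j' ->
       (A *m \adj B) i j = (A *m \adj B) i j') ->
  (integrality_number R A b <= `|\det B| * #|T| + `|\det B|)%N.
Proof.
move=> B B0 Ac.
have [T1 [c1 [V [Q [Uu Vc cardT1 cardV]]]]] := quotient_characters B0.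
pose C i := (c1 i, c i).
pose I := ((T1 * T)%type + {k | row k V != 0})%type.
pose w (s : I) : 'rV[int]_n :=
  match s with
  | inl t => \sum_(i | C i == t) row i B
  | inr k => row (val k) V
  end.
apply: (@leq_trans #|{: I}|); last first.
  rewrite card_sum card_prod cardT1 leq_add2l card_sig.
  exact: leq_trans (ltnW (ltn_expl _ _)) cardV.
apply: (integrality_number_le_card (w := w)) => x Px wx.
have BR : (map_mx intr B : 'M[R]_n) \in unitmx.
  by rewrite unitmxE det_map_mx unitfE intr_eq0.
pose bf : 'cV[R]_n := \col_i (b (f i) 0)%:~R.
pose X (z : 'cV[R]_n) : 'cV[R]_n := invmx (map_mx intr B) *m (bf - z).
have BX z : map_mx intr B *m X z = bf - z by rewrite mulKVmx.
have AfE i z : (map_mx intr A *m z) (f i) 0 = (map_mx intr B *m z) i 0 :> R.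
  by rewrite !mxE; apply: eq_bigr => j _; rewrite !mxE.
pose y := bf - map_mx intr B *m x.
have yE i : y i 0 = (b (f i) 0)%:~R - (map_mx intr B *m x) i 0.
  by rewrite !mxE.
have -> : x = X y by rewrite /X /y opprB addrC subrK mulKmx.
apply: (class_sum_rounding (c := C) (Q := fun z => integer_hull R A b (X z))).
- move=> u v t t01 hu hv.
  have -> : X (t *: u + (1 - t) *: v) = t *: X u + (1 - t) *: X v.
    rewrite /X !scalemxAr -mulmxDr; congr (_ *m _).
    by apply/colP => i; rewrite !mxE; ring.
  exact: integer_hull_conv.
- by move=> i; rewrite yE subr_ge0 -AfE; apply: Px.
- move=> t; have /= := wx (inl t).
  rewrite raddf_sum mulmx_suml summxE => wt.
  rewrite /class_sum (eq_bigr _ (fun i _ => yE i)) sumrB.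
  apply: rpredB; first by apply: rpred_sum => i _; exact: intr_int.
  by move: wt; rewrite (eq_bigr _ (fun i _ => mulmx_int_row B x i)).
move=> z z0 zint zy.
(* Replacing the slack y by z does not change the value of a form that is
   constant on the classes. *)
have sameC (u : 'rV[int]_n) :
    (forall i j, C i = C j -> (u *m \adj B) 0 i = (u *m \adj B) 0 j) ->
    map_mx intr u *m X z = map_mx intr u *m x.
  move=> uC; apply/eqP; rewrite -subr_eq0 -mulmxBr; apply/eqP.
  apply: (class_constant_row_eq0 B0 uC) => t.
  rewrite mulmxBr BX.
  transitivity (class_sum C y t - class_sum C z t).
    rewrite /class_sum -sumrB; apply: eq_bigr => i _.
    by rewrite /y !mxE; ring.
  by rewrite zy subrr.
apply: sub_gen_smallest; split.
  move=> i; have [/codomP[j ->]|fi] := boolP (i \in codom f).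
    by rewrite AfE BX !mxE gerBl.
  rewrite -mulmx_int_row sameC ?mulmx_int_row //.
  by move=> j j' [_ cjj']; rewrite -row_mul ![row _ _ _ _]mxE; apply: Ac.
have Vint : map_mx intr V *m X z \is a mxOver Num.int.
  apply/mxOverP => k j; rewrite (ord1 j) -mulmx_int_row sameC.
    have [->|Vk] := eqVneq (row k V) 0; last exact: (wx (inr (exist _ k Vk))).
    by rewrite map_mx0 mul0mx mxE.
  by move=> i i' [cii' _]; rewrite -row_mul ![row _ _ _ _]mxE; apply: Vc.
(* V is integral at X z, and Q B takes there the value Q (bf - z). *)
have Uint : map_mx intr (V + Q *m B) *m X z \is a mxOver Num.int.
  have sint : bf - z \is a mxOver Num.int.
    apply/mxOverP => i j; rewrite (ord1 j) !mxE.
    by apply: rpredB; [exact: intr_int | exact: (mxOverP zint)].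
  rewrite map_mxD map_mxM mulmxDl -mulmxA BX.
  apply/mxOverP => i j; rewrite mxE; apply: rpredD; first exact: (mxOverP Vint).
  exact: (mxOverP (mxOverM (mxOver_int_map R Q) sint)).
rewrite -[X z]mul1mx -(map_mx1 intr) -(mulVmx Uu) map_mxM -mulmxA.
by rewrite mxOverM // mxOver_int_map.
Qed.

(** * Subdeterminants and row exchanges *)

(** The inverse of [s] sends [i] to the rank of [f i] among the values of [f].
    Reindexing turns any injective choice of rows into a submatrix in the
    increasing order that [non_degenerate] and [Delta] require. *)
Lemma increasing_reindex m n (f : 'I_n -> 'I_m) : injective f ->
  exists s : 'S_n, increasing (fun k => f (s k)).
Proof.
move=> finj; pose below i := [set j | (f j < f i)%N].
have rank_lt i : (#|below i| < n)%N.
  rewrite -[X in (_ < X)%N](card_ord n); apply: proper_card.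
  by apply/properP; split; [exact: subset_predT | exists i; rewrite // inE ltnn].
have rank_mono i j : (f i < f j)%N -> (#|below i| < #|below j|)%N.
  move=> ij; apply: proper_card; apply/properP; split.
    by apply/fintype.subsetP => k; rewrite !inE => /ltn_trans; apply.
  by exists i; rewrite !inE ?ltnn.
pose r i := Ordinal (rank_lt i).
have rinj : injective r.
  move=> i j /(congr1 val) /= ij; apply: finj; apply: val_inj => /=.
  by case: (ltngtP (f i) (f j)) => // /rank_mono; rewrite ij ltnn.
have rankK (k : 'I_n) : #|below ((perm rinj)^-1%g k)| = k.
  by rewrite -[in RHS](permKV (perm rinj) k) permE.
exists (perm rinj)^-1%g; apply/forallP => k; apply/forallP => l.
apply/implyP; rewrite -{1}(rankK k) -{1}(rankK l).
rewrite ltnNge; apply: contraR; rewrite -leqNgt leq_eqVlt => /orP[/eqP fE|].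
  by rewrite (finj _ _ (val_inj fE)).
by move/rank_mono/ltnW.
Qed.

Lemma absz_det_row_perm n (s : 'S_n) (B : 'M[int]_n) :
  `|\det (row_perm s B)|%N = `|\det B|%N.
Proof. by rewrite row_permE det_mulmx det_perm abszMsign. Qed.

Lemma non_degenerate_det_neq0 m n (A : 'M[int]_(m, n)) (f : 'I_n -> 'I_m) :
  non_degenerate A -> injective f -> \det (rowsub f A) != 0.
Proof.
move=> And /increasing_reindex[s fs].
have idinc : increasing (id : 'I_n -> 'I_n).
  by apply/forallP => i; apply/forallP => j; apply/implyP.
have := And _ _ fs idinc.
have -> : mxsub (fun k => f (s k)) id A = row_perm s (rowsub f A).
  by apply/matrixP => i j; rewrite !mxE.
by rewrite -!absz_gt0 absz_det_row_perm.
Qed.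

Lemma absz_det_le_Delta m n (A : 'M[int]_(m, n)) (f : 'I_n -> 'I_m) :
  int_rank A = n -> injective f -> (`|\det (rowsub f A)| <= Delta A)%N.
Proof.
move=> rA /increasing_reindex[s fs]; rewrite /Delta rA.
have finc : increasing [ffun k => f (s k)].
  apply/forallP => i; apply/forallP => j; rewrite !ffunE.
  by move/forallP/(_ i)/forallP/(_ j): fs.
have ginc : increasing [ffun k : 'I_n => k].
  by apply/forallP => i; apply/forallP => j; rewrite !ffunE; apply/implyP.
apply: leq_trans (leq_bigmax_cond _ finc).
apply: leq_trans (leq_bigmax_cond _ ginc).
rewrite -(absz_det_row_perm s) eq_leq //; congr (`|\det _|%N).
by apply/matrixP => i j; rewrite !mxE !ffunE.
Qed.

Definition exchange m n (f : 'I_n -> 'I_m) j i : 'I_n -> 'I_m :=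
  fun k => if k == j then i else f k.

Lemma exchange_inj m n (f : 'I_n -> 'I_m) j i :
  injective f -> i \notin codom f -> injective (exchange f j i).
Proof.
move=> finj fi k l; rewrite /exchange.
case: eqP => [->|_]; case: eqP => [->|_] // E.
- by rewrite E codom_f in fi.
- by rewrite -E codom_f in fi.
exact: finj.
Qed.

(** Laplace expansion along the new row, whose cofactors are those of the old
    one. *)
Lemma det_exchange m n (A : 'M[int]_(m, n)) (f : 'I_n -> 'I_m) j i :
  \det (rowsub (exchange f j i) A) = (A *m \adj (rowsub f A)) i j.
Proof.
rewrite (expand_det_row _ j) mxE; apply: eq_bigr => k _.
rewrite mxE /exchange eqxx [in RHS]mxE; congr (_ * (_ * \det _)).
by apply/matrixP => l l'; rewrite !mxE eq_sym (negPf (neq_lift _ _)).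
Qed.

(** The column [adj B * (e_j1 - e_j2)] is killed by the rows of [B] other than
    [j1] and [j2], and by rows [i1] and [i2] because the entries agree. *)
Lemma double_exchange_det_eq0 m n (A : 'M[int]_(m, n)) (f : 'I_n -> 'I_m)
    i1 i2 j1 j2 : let M := A *m \adj (rowsub f A) in
    \det (rowsub f A) != 0 -> j1 != j2 ->
    M i1 j1 = M i1 j2 -> M i2 j1 = M i2 j2 ->
  \det (rowsub (exchange (exchange f j1 i1) j2 i2) A) = 0.
Proof.
set B := rowsub f A => M B0 j12 E1 E2.
pose v := \adj B *m (delta_mx j1 0 - delta_mx j2 0 : 'cV[int]_n).
have BvE k : (B *m v) k 0 = \det B * ((k == j1)%:R - (k == j2)%:R).
  by rewrite /v mulmxA mul_mx_adj mul_scalar_mx !mxE !eqxx !andbT.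
have AvE i : (A *m v) i 0 = M i j1 - M i j2.
  rewrite /v mulmxA -/M mulmxBr -!colE mxE [X in _ + X]mxE.
  by congr (_ - _); rewrite mxE.
apply/eqP; rewrite -det_tr; apply/det0P; exists v^T.
  apply: contraNneq B0 => v0; have := BvE j1.
  rewrite -[v]trmxK v0 trmx0 mulmx0 mxE eqxx (negPf j12) subr0 mulr1.
  by move=> <-.
rewrite -trmx_mul; apply/matrixP => l k; rewrite (ord1 l) [LHS]mxE [RHS]mxE.
set g := exchange _ _ _.
have -> : (rowsub g A *m v) k 0 = (A *m v) (g k) 0.
  by rewrite !mxE; apply: eq_bigr => l' _; rewrite !mxE.
rewrite /g /exchange; case: eqP => [_|/eqP k2]; first by rewrite AvE E2 subrr.
case: eqP => [_|/eqP k1]; first by rewrite AvE E1 subrr.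
transitivity ((B *m v) k 0).
  by rewrite !mxE; apply: eq_bigr => l' _; rewrite !mxE.
by rewrite BvE (negPf k1) (negPf k2) subrr mulr0.
Qed.

Definition int_code (d : nat) (x : int) : 'I_(d.*2.+1) := inord `|x + d%:Z|.

Lemma int_code_inj d x y : (`|x| <= d)%N -> (`|y| <= d)%N ->
  int_code d x = int_code d y -> x = y.
Proof.
move=> xd yd /(congr1 val); rewrite /= !inordK; lia.
Qed.

(** * Bounds in terms of the largest subdeterminant *)

(** For large [n] there is at most one row outside the first [n], and its
    entries in [A * adj B], coded by [2 Delta + 1] values, define the classes. *)
Theorem integrality_number_le_square (R : realType) m n (A : 'M[int]_(m, n))
    (b : 'cV[int]_m) : non_degenerate A -> int_rank A = n ->
  (integrality_number R A b <= (Delta A).*2.+1 ^ 2)%N.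
Proof.
move=> And rA; set d := Delta A.
have [nd|dn] := leqP n (d.*2.+1 ^ 2).
  exact: leq_trans (integrality_number_le_dim R A b) nd.
have nm : (n <= m)%N by rewrite -rA; exact: rank_leq_row.
pose f := widen_ord nm; pose B := rowsub f A; pose M := A *m \adj B.
have finj : injective f by move=> i j /(congr1 val) /= /val_inj.
have B0 : \det B != 0 by apply: non_degenerate_det_neq0.
have Bd : (`|\det B| <= d)%N by apply: absz_det_le_Delta.
have Md i j : i \notin codom f -> (`|M i j| <= d)%N.
  by move=> fi; rewrite -det_exchange absz_det_le_Delta //; apply: exchange_inj.
have code_eq i j j' : i \notin codom f ->
    int_code d (M i j) = int_code d (M i j') -> M i j = M i j'.
  by move=> fi; apply: int_code_inj; apply: Md.
(* Two rows outside B would make the columns inject into pairs of codes. *)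
have one_outside i1 i2 : i1 \notin codom f -> i2 \notin codom f -> i1 = i2.
  move=> f1 f2; apply: contraTeq dn => i12; rewrite -leqNgt.
  pose h j := (int_code d (M i1 j), int_code d (M i2 j)).
  rewrite -mulnn -[d.*2.+1]card_ord -card_prod -[n in (n <= _)%N]card_ord.
  apply: (leq_card h) => j1 j2 [/code_eq E1 /code_eq E2].
  apply: contrapT => /eqP j12.
  have := double_exchange_det_eq0 B0 j12 (E1 f1) (E2 f2).
  apply/eqP; apply: non_degenerate_det_neq0 => //.
  apply: exchange_inj; first exact: exchange_inj.
  apply/codomP => -[k]; rewrite /exchange; case: eqP => [_ E|_ E].
    by rewrite E eqxx in i12.
  by rewrite E codom_f in f2.
have [c Mc] : exists c : 'I_n -> 'I_(d.*2.+1), forall i, i \notin codom f ->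
    forall j j', c j = c j' -> M i j = M i j'.
  have [i0 f0|fall] := pickP [pred i | i \notin codom f].
    exists (fun j => int_code d (M i0 j)) => i fi j j'.
    by rewrite (one_outside i i0 fi f0); apply: code_eq.
  by exists (fun=> ord0) => i fi; have := fall i; rewrite /= fi.
apply: leq_trans (integrality_number_classes R b B0 Mc) _.
rewrite card_ord -mulnSr.
apply: (@leq_trans (d * d.*2.+2)); first by rewrite leq_mul2r Bd orbT.
by rewrite -mulnn -addnn; nia.

Qed.

Theorem corollary2 (R : realType) (m n : nat) (A : 'M[int]_(m, n))
    (hA : non_degenerate A) (hrank : int_rank A = n)
    (hDelta : (2 <= Delta A)%N) (b : 'cV[int]_m) :
  (integrality_number R A b)%:R <=
    (4 * (Delta A)%:R `^ (2^-1) + log2 (Delta A)%:R)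
    * ((Delta A)%:R `^ (6 + log2 (log2 (Delta A)%:R)) + 1) :> R.
Proof.
set d : R := (Delta A)%:R.
have d2 : 2 <= d by rewrite (ler_nat R 2).
have ln2 : 0 < ln (2 : R) by rewrite ln_gt0 // ltr1n.
have log_ge1 : 1 <= log2 d.
  by rewrite ler_pdivlMr // mul1r ler_ln ?posrE //; lra.
have loglog_ge0 : 0 <= log2 (log2 d).
  by apply: divr_ge0; [exact: ln_ge0 | exact: ltW].
have sqrt_ge1 : 1 <= d `^ 2^-1.
  by rewrite -[leLHS](powRr0 d); apply: ler_powR; lra.
have pow_ge : d ^+ 6 <= d `^ (6 + log2 (log2 d)).
  rewrite -powR_mulrn; last by lra.
  by apply: ler_powR; lra.
apply: (@le_trans _ _ ((2 * d + 1) ^+ 2)).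
  have : (integrality_number R A b)%:R <= ((Delta A).*2.+1 ^ 2)%:R :> R.
    by rewrite ler_nat integrality_number_le_square.
  by rewrite natrX -addn1 natrD -mul2n natrM.
have d4 : 2 ^+ 4 <= d ^+ 4 by rewrite lerXn2r ?nnegrE //; lra.
apply: (@le_trans _ _ (4 * (d ^+ 6 + 1))).
  have -> : d ^+ 6 = d ^+ 4 * d ^+ 2 by ring.
  nra.
by apply: ler_pM; nra.
Qed.
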